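(* Let $1<p<\infty$, let $v:\mathbb{N}\to[0,\infty)$ and $w:\mathbb{N}\to\mathbb{R}$ be functions, and let $\varphi:\mathbb{N}_0\to[0,\infty)$ satisfy $\varphi(0)=0$ and $\varphi(n+1)\ge\varphi(n)>0$ for all $n\in\mathbb{N}$. Assume that for all $n\in\mathbb{N}$ $$v(n)\bigl(\varphi(n)-\varphi(n-1)\bigr)^{p-1}-v(n+1)\bigl(\varphi(n+1)-\varphi(n)\bigr)^{p-1}\ \ge\ w(n)\,\varphi(n)^{p-1}. \qquad ( * )$$ Then for every complex-valued $u\in C_c(\mathbb{N}_0)$ with $u(0)=0$, $$\sum_{n=1}^{\infty}v(n)|u(n)-u(n-1)|^p\ \ge\ \sum_{n=1}^{\infty}w(n)|u(n)|^p+\sum_{n=2}^{\infty}v(n)R_p(u(n),\varphi(n)), \qquad ( ** )$$ where for each $n\ge2$ $$R_p(u(n),\varphi(n)):=C_p\!\left(u(n)-u(n-1),\ \frac{\varphi(n-1)}{\varphi(n)}u(n)-u(n-1)\right)+\varphi(n-1)\bigl(\varphi(n)-\varphi(n-1)\bigr)^{p-1}C_p\!\left(\frac{u(n-1)}{\varphi(n-1)},\ \frac{u(n-1)}{\varphi(n-1)}-\frac{u(n)}{\varphi(n)}\right).$$ Consequently, if $v(n)>0$ for every $n\ge2$, then the remainder term $\sum_{n=2}^{\infty}v(n)R_p(u(n),\varphi(n))$ vanishes if and only if there is $c\in\mathbb{C}$ such that $u(n)=c\,\varphi(n)$ for every $n\in\mathbb{N}$. Moreover, equality holds in $( ** )$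 if $( * )$ holds with equality for all $n\in\mathbb{N}$.
   Context: $\mathbb{N}=\{1,2,3,\dots\}$, $\mathbb{N}_0=\{0,1,2,\dots\}$, and $C_c(\mathbb{N}_0)$ denotes the set of finitely supported sequences on $\mathbb{N}_0$. For $1<p<\infty$ and $\xi,\eta\in\mathbb{C}$, $$C_p(\xi,\eta):=|\xi|^p-|\xi-\eta|^p-p|\xi-\eta|^{p-2}\operatorname{Re}\bigl((\xi-\eta)\overline{\eta}\bigr),$$ where the last term is understood to be $0$ when $\xi=\eta$. *)

(* Defs.v *)
From mathcomp Require Import all_boot all_order all_algebra.
From mathcomp Require Import all_classical all_reals all_analysis.
From mathcomp Require Import complex.

Set Implicit Arguments.
Unset Strict Implicit.
Unset Printing Implicit Defensive.

Import Order.TTheory GRing.Theory Num.Theory.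
Import numFieldNormedType.Exports.

Local Open Scope classical_set_scope.
Local Open Scope ring_scope.
Local Open Scope complex_scope.

(* Real-valued series as the limit of partial sums (the library only declares
   this notation for extended reals). *)
Notation "\sum_ ( m <= i <oo ) F" :=
  (\big[+%R/0%R]_(m <= i <oo) F%R) : ring_scope.

(* [`|z|] on [R[i]] is itself complex-valued; [cabs] is the library's
   real-valued modulus. *)
Definition cabs (R : realType) (z : R[i]) : R := ComplexField.Normc.normc z.

Definition Cp (R : realType) (p : R) (xi eta : R[i]) : R :=
  cabs xi `^ p - cabs (xi - eta) `^ p
  - (if xi == eta then 0
     else p * cabs (xi - eta) `^ (p - 2)
            * complex.Re ((xi - eta) * conjc eta)).

(* Only used for [n >= 2]; [n.-1] is then the genuine predecessor. *)
Definition Rp (R : realType) (p : R) (phi : nat -> R) (u : nat -> R[i])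
    (n : nat) : R :=
  Cp p (u n - u n.-1) ((phi n.-1 / phi n)%:C * u n - u n.-1)
  + phi n.-1 * (phi n - phi n.-1) `^ (p - 1)
    * Cp p (u n.-1 / (phi n.-1)%:C)
           (u n.-1 / (phi n.-1)%:C - u n / (phi n)%:C).

(* Main.v *)
Require Import Defs.
From mathcomp Require Import all_boot all_order all_algebra.
From mathcomp Require Import all_classical all_reals all_analysis.
From mathcomp Require Import complex ring lra zify.

Set Implicit Arguments.
Unset Strict Implicit.
Unset Printing Implicit Defensive.

Import Order.TTheory GRing.Theory Num.Theory.
Import numFieldNormedType.Exports.

Local Open Scope classical_set_scope.
Local Open Scope ring_scope.
Local Open Scope complex_scope.

(** The inequality is an identity with one term thrown away.  For
    [n >= 2] put [a = phi n.-1] and [b = phi n]; the substitution [u n = b x],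
    [u n.-1 = a y] makes the energy density split exactly
    ([discrete_picone]):
      [|u n - u n.-1|^p = Rp n + (b - a)^(p-1) (g n - g n.-1)],
    where [g n = |u n|^p / phi n ^ (p-1)].  The reason is that [Cp p xi eta]
    is the error of the tangent of [|.|^p] at [xi - eta], evaluated at [xi];
    the two tangents entering [Rp] are taken at [(b - a) x] and at [x], which
    are proportional, and the weight [a (b - a)^(p-1)] of the second one is
    what makes their linear parts cancel.

    Multiplying by [v n] and summing by parts moves the differences of [g]
    onto [D n = v n (phi n - phi n.-1)^(p-1)]
    ([sum_by_parts]; boundary terms vanish because [u] is zero at [0] and far
    away).  Hence the energy equals the total remainder plus the sum of
    [(D n - D n.+1) g n], and the hypothesis on [phi] bounds
    [(D n - D n.+1) g n] below by [w n |u n|^p], with equality if that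
    hypothesis is an equality.

    For the vanishing of the remainder, strict convexity of [|.|^p] gives
    [Cp p xi eta > 0] unless [eta = 0] ([Cp_gt0]).  So [Rp n = 0] exactly when
    [u / phi] takes the same value at [n.-1] and [n] ([Rp_eq0]), even if
    [phi n = phi n.-1] kills the second summand, since the first one alone
    decides. *)

(** * The modulus of complex numbers *)

Section Modulus.
Variable R : realType.
Implicit Types z x : R[i].

Lemma cabs_ge0 z : 0 <= cabs z.
Proof. by case: z => a b; rewrite /cabs /= sqrtr_ge0. Qed.

Lemma cabs_eq0 z : cabs z = 0 -> z = 0.
Proof. exact: ComplexField.Normc.eq0_normc. Qed.

Lemma cabs0 : cabs (0 : R[i]) = 0.
Proof. exact: ComplexField.Normc.normc0. Qed.

Lemma cabsZ (r : R) z : 0 <= r -> cabs (r%:C * z) = r * cabs z.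
Proof.
move=> r0; rewrite /cabs ComplexField.Normc.normcM /=.
by rewrite expr0n addr0 sqrtr_sqr ger0_norm.
Qed.

Lemma sqr_cabs z : cabs z ^+ 2 = complex.Re (z * conjc z).
Proof.
case: z => a b; rewrite /cabs /= sqr_sqrtr ?addr_ge0 ?sqr_ge0//.
ring.
Qed.

Lemma ReB z x : complex.Re (z - x) = complex.Re z - complex.Re x.
Proof. by case: z x => a b [c d]. Qed.

Lemma sqr_cabsB z x :
  cabs (z - x) ^+ 2
  = cabs z ^+ 2 + cabs x ^+ 2 - 2 * complex.Re (z * conjc x).
Proof.
rewrite !sqr_cabs; case: z x => a b [c d] /=; ring.
Qed.

(** Cauchy-Schwarz in the real plane: the defect of the squares is the square
    of the determinant of the two vectors. *)
Lemma Re_mul_conj_le z x : complex.Re (z * conjc x) <= cabs z * cabs x.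
Proof.
apply: le_trans (ler_norm _) _.
rewrite -(@ler_pXn2r _ 2) ?nnegrE ?mulr_ge0 ?cabs_ge0//.
rewrite exprMn !sqr_cabs real_normK ?num_real//; case: z x => a b [c d] /=.
rewrite -subr_ge0.
rewrite (_ : _ - _ = (a * d - b * c) ^+ 2) ?sqr_ge0//; ring.
Qed.

End Modulus.

(** * Strict convexity of the power of the modulus *)

Section Tangent.
Variable R : realType.
Implicit Type p : R.

Lemma powRB1 p (s : R) : 1 < p -> 0 <= s -> s `^ p = s * s `^ (p - 1).
Proof.
move=> p_gt1 s0; rewrite -{2}(powRr1 s0) -powRD; first by congr (_ `^ _); ring.
by rewrite [1 + _]addrC subrK gt_eqF//; lra.
Qed.

(** This holds at [s = 0] too, although [0 `^ 0 = 1]: the factor [s] absorbs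
    the value of [s `^ (p - 2)], and [p - 1] is never zero. *)
Lemma powRB2 p (s : R) : 1 < p -> 0 <= s -> s * s `^ (p - 2) = s `^ (p - 1).
Proof.
move=> p_gt1; rewrite le_eqVlt => /predU1P[<-|s0];
  first by rewrite mul0r powR0//; lra.
rewrite -{1}(powRr1 (ltW s0)) -powRD; first by congr (_ `^ _); ring.
by apply/implyP => _; rewrite gt_eqF.
Qed.

(** Strict Bernoulli inequality.  If [r > 0], then [r = exp t] and
    [r^p = r exp ((p-1) t)]; the bound [1 + x <= exp x] is used twice: at
    [(p-1) t], and strictly at [- t], which yields [r t > r - 1]. *)
Lemma bernoulli_powR p (r : R) : 1 < p -> 0 <= r -> r != 1 ->
  1 + p * (r - 1) < r `^ p.
Proof.
move=> p_gt1; rewrite le_eqVlt => /predU1P[<- _|r0 r1];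
  first by rewrite powR0; lra.
have x0 : ln r != 0 by rewrite ln_eq0.
rewrite powRB1 ?ltW// [_ `^ _]/powR gt_eqF//.
have e1 := expR_ge1Dx ((p - 1) * ln r).
have e2 : 1 + - ln r < expR (- ln r) by rewrite expR_gt1Dx// oppr_eq0.
rewrite expRN lnK ?posrE// -(ltr_pM2l r0) mulfV ?gt_eqF// in e2.
apply: (@lt_le_trans _ _ (r * (1 + (p - 1) * ln r))); last by rewrite ler_pM2l.
nra.
Qed.

(** Homogeneous form of [bernoulli_powR], with [r = t / s]. *)
Lemma tangent_powR_lt p (s t : R) : 1 < p -> 0 < s -> 0 <= t -> t != s ->
  s `^ p + p * s `^ (p - 1) * (t - s) < t `^ p.
Proof.
move=> p_gt1 s0 t0 ts.
have rs : t / s != 1 by apply: contra ts => /eqP /(divr1_eq) ->.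
have := bernoulli_powR p_gt1 (divr_ge0 t0 (ltW s0)) rs.
have sp : 0 < s `^ p by rewrite powR_gt0.
have s0' := ltW s0.
rewrite -(ltr_pM2l sp) -powRM ?divr_ge0// [s * _]mulrC divfK ?gt_eqF//.
congr (_ < _); rewrite powRB1 ?ltW//; field.
by rewrite gt_eqF.
Qed.

(** The case distinction of [Cp] is absorbed by the factor [xi - eta]. *)
Lemma CpE p (xi eta : R[i]) :
  Cp p xi eta = cabs xi `^ p - cabs (xi - eta) `^ p
  - p * (cabs (xi - eta) `^ (p - 2) * complex.Re ((xi - eta) * conjc eta)).
Proof.
rewrite /Cp; case: eqP => [->|_]; last by rewrite !mulrA.
by rewrite subrr mul0r /= !mulr0.
Qed.

Lemma Cp0 p (xi : R[i]) : Cp p xi 0 = 0.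
Proof. by rewrite CpE subr0 conjc0 mulr0 /= !mulr0 subrr subr0. Qed.

(** Write [z = xi - eta].  Cauchy-Schwarz reduces the claim to the tangent
    inequality for [t `^ p] at [|z|], which is strict when [|xi| <> |z|].  When
    the moduli agree, Cauchy-Schwarz itself is strict because [z <> xi].  At
    [z = 0] the tangent vanishes and [Cp p xi eta = |xi|^p]. *)
Lemma Cp_gt0 p (xi eta : R[i]) : 1 < p -> eta != 0 -> 0 < Cp p xi eta.
Proof.
move=> p_gt1 eta0; rewrite CpE.
have : xi - eta != xi.
  by apply: contra eta0 => /eqP h; rewrite -(subKr xi eta) h subrr.
have -> : (xi - eta) * conjc eta
    = (xi - eta) * conjc xi - (xi - eta) * conjc (xi - eta).
  by rewrite -mulrBr -rmorphB /= subKr.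
move: (xi - eta) => z zxi; rewrite ReB -sqr_cabs.
have [s0|s0] := eqVneq (cabs z) 0.
  have z0 := cabs_eq0 s0.
  rewrite z0 cabs0 mul0r /= expr0n /= powR0 ?subr0 ?mulr0 ?subr0; last lra.
  rewrite powR_gt0// lt_neqAle cabs_ge0 andbT eq_sym.
  by apply: contra zxi => /eqP/cabs_eq0 ->; rewrite z0.
have {}s0 : 0 < cabs z by rewrite lt_neqAle cabs_ge0 eq_sym s0.
have e1 := powRB2 p_gt1 (ltW s0).
have s2 : 0 < cabs z `^ (p - 2) by rewrite powR_gt0.
have [ts|ts] := eqVneq (cabs xi) (cabs z).
  (* Equal moduli: the law of cosines makes Re (z conj xi) < |z|^2. *)
  have : 0 < cabs (z - xi) ^+ 2.
    rewrite exprn_gt0// lt_neqAle cabs_ge0 andbT eq_sym.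
    by apply: contra zxi => /eqP/cabs_eq0/subr0_eq ->.
  rewrite sqr_cabsB ts => h.
  rewrite subrr sub0r -mulrN mulr_gt0//; first lra.
  rewrite -mulrN mulr_gt0//; nra.
have := tangent_powR_lt p_gt1 s0 (cabs_ge0 xi) ts.
rewrite -e1.
have : cabs z `^ (p - 2) * complex.Re (z * conjc xi)
    <= cabs z `^ (p - 2) * (cabs z * cabs xi).
  by rewrite ler_pM2l// Re_mul_conj_le.
set A := _ `^ (p - 2); set B := complex.Re _.
have p0 : 0 < p by lra.
rewrite -(ler_pM2l p0); nra.
Qed.

Lemma Cp_ge0 p (xi eta : R[i]) : 1 < p -> 0 <= Cp p xi eta.
Proof.
move=> p_gt1; have [->|/(Cp_gt0 xi p_gt1)/ltW//] := eqVneq eta 0.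
by rewrite Cp0.
Qed.

Lemma Cp_eq0 p (xi eta : R[i]) : 1 < p -> Cp p xi eta = 0 <-> eta = 0.
Proof.
move=> p_gt1; split=> [h|->]; last exact: Cp0.
by apply/eqP; apply: contraT => /(Cp_gt0 xi p_gt1); rewrite h ltxx.
Qed.

End Tangent.

(** * The remainder and the discrete Picone identity *)

Section Remainder.
Variables (R : realType) (p : R).
Hypothesis p_gt1 : 1 < p.
Variables (phi : nat -> R) (u : nat -> R[i]) (n : nat).
Hypotheses (a_gt0 : 0 < phi n.-1) (le_ab : phi n.-1 <= phi n).

Let b_gt0 : 0 < phi n. Proof. exact: lt_le_trans a_gt0 le_ab. Qed.

Lemma Rp_ge0 : 0 <= Rp p phi u n.
Proof. by rewrite addr_ge0 ?mulr_ge0 ?powR_ge0 ?Cp_ge0// ltW. Qed.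

(** The first summand of [Rp] already forces the equality of quotients; the
    second one can have weight zero. *)
Lemma Rp_eq0 : Rp p phi u n = 0 <->
  u n.-1 / (phi n.-1)%:C = u n / (phi n)%:C.
Proof.
have ca0 : (phi n.-1)%:C != 0 by rewrite fmorph_eq0 gt_eqF.
have cb0 : (phi n)%:C != 0 by rewrite fmorph_eq0 gt_eqF.
have Eab : (phi n.-1 / phi n)%:C = (phi n.-1)%:C / (phi n)%:C.
  by rewrite fmorph_div.
split=> [/eqP|h].
  rewrite paddr_eq0 ?mulr_ge0 ?powR_ge0 ?Cp_ge0// ?ltW//.
  move=> /andP[/eqP /(Cp_eq0 _ _ p_gt1) h _].
  have <- := subr0_eq h; rewrite Eab; field.
  by rewrite ca0 cb0.
rewrite /Rp h subrr Cp0 mulr0 addr0.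
rewrite [X in Cp p _ X](_ : _ = 0) ?Cp0//.
by rewrite Eab -[X in _ - X](divfK ca0) h; field.
Qed.

(** With [u n = b x], [u n.-1 = a y] and [d = b - a], the two tangent points
    are [d x] and [x].  Their linear parts are opposite multiples of
    [d^(p-1) |x|^(p-2) Re (x conj (y - x))], and what remains is
    [d^p + a d^(p-1) = b d^(p-1)]. *)
Lemma discrete_picone :
  cabs (u n - u n.-1) `^ p = Rp p phi u n
    + (phi n - phi n.-1) `^ (p - 1)
      * (cabs (u n) `^ p / phi n `^ (p - 1)
         - cabs (u n.-1) `^ p / phi n.-1 `^ (p - 1)).
Proof.
rewrite /Rp; move: a_gt0 b_gt0 le_ab.
move: (phi n.-1) (phi n) (u n.-1) (u n) => a b V U a0 b0 ab.
have ca0 : a%:C != 0 by rewrite fmorph_eq0 gt_eqF.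
have cb0 : b%:C != 0 by rewrite fmorph_eq0 gt_eqF.
have Eab : (a / b)%:C = a%:C / b%:C by rewrite fmorph_div.
have [x ->] : exists x, U = b%:C * x by exists (U / b%:C); field.
have [y ->] : exists y, V = a%:C * y by exists (V / a%:C); field.
rewrite !CpE.
have -> : a%:C * y / a%:C = y by field.
have -> : b%:C * x / b%:C = x by field.
have -> : (a / b)%:C * (b%:C * x) - a%:C * y = a%:C * (x - y).
  by rewrite Eab; field.
have -> : b%:C * x - a%:C * y - a%:C * (x - y) = (b - a)%:C * x.
  by rewrite rmorphB /=; ring.
rewrite subKr.
have d0 : 0 <= b - a by rewrite subr_ge0.
rewrite !cabsZ ?(ltW a0) ?(ltW b0)//.
rewrite !powRM ?cabs_ge0 ?(ltW a0) ?(ltW b0)//.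
have -> : complex.Re ((b - a)%:C * x * conjc (a%:C * (x - y)))
   = - ((b - a) * a * complex.Re (x * conjc (y - x))).
  by case: (x) (y) => x1 x2 [y1 y2] /=; ring.
move: (complex.Re _) => r.
rewrite (powRB1 p_gt1 (ltW a0)) (powRB1 p_gt1 (ltW b0)).
rewrite (powRB1 p_gt1 d0) -(powRB2 p_gt1 d0).
have : a `^ (p - 1) != 0 by rewrite powR_eq0 gt_eqF.
have : b `^ (p - 1) != 0 by rewrite powR_eq0 gt_eqF.
move=> A B; field.
by rewrite A B.
Qed.

End Remainder.

(** * Sums of finite support *)

Section Summation.
Variable R : realType.

Lemma finite_support_bound (V : nmodType) (u : nat -> V) :
  finite_set [set n | u n != 0] ->
  exists N, forall n, (N <= n)%N -> u n = 0.
Proof.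
move=> /finite_seqP[s us]; exists (\max_(i <- s) i).+1 => n Nn.
apply/eqP; apply: contraT => un.
have : [set n | u n != 0] n by [].
rewrite us /= => ns; have := @leq_bigmax_seq _ s xpredT (fun i => i) n ns isT.
by move=> /(leq_trans Nn); rewrite ltnn.
Qed.

Lemma lim_sum_eventually0 (F : nat -> R) (m N : nat) : (m <= N)%N ->
  (forall n, (N <= n)%N -> F n = 0) ->
  \sum_(m <= n <oo) F n = \sum_(m <= n < N) F n.
Proof.
move=> mN F0; apply: norm_lim_near_cst.
exists N => //= M /= NM; rewrite (big_cat_nat mN NM)/=.
rewrite [X in _ + X]big_nat [X in _ + X]big1 ?addr0// => i /andP[Ni _].
exact: F0.
Qed.

Lemma sum_by_parts (D g : nat -> R) (N : nat) : g 0%N = 0 -> g N = 0 ->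
  \sum_(1 <= n < N.+1) D n * (g n - g n.-1)
  = \sum_(1 <= n < N.+1) (D n - D n.+1) * g n.
Proof.
move=> g0 gN; apply/eqP; rewrite -subr_eq0 -sumrB big_add1 /=.
rewrite (eq_bigr (fun k => D k.+2 * g k.+1 - D k.+1 * g k)); last first.
  by move=> k _; ring.
by rewrite (telescope_sumr (fun k => D k.+1 * g k))// g0 gN !mulr0 subrr.
Qed.

End Summation.

(** * The Hardy inequality with remainder *)

Theorem theorem3p1 (R : realType) (p : R) (v w phi : nat -> R)
  (p_gt1 : 1 < p)
  (v_ge0 : forall n : nat, (1 <= n)%N -> 0 <= v n)
  (phi0 : phi 0%N = 0)
  (phi_gt0 : forall n : nat, (1 <= n)%N -> 0 < phi n)
  (phi_mono : forall n : nat, (1 <= n)%N -> phi n <= phi n.+1)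
  (supersol : forall n : nat, (1 <= n)%N ->
    v n * (phi n - phi n.-1) `^ (p - 1)
      - v n.+1 * (phi n.+1 - phi n) `^ (p - 1)
    >= w n * phi n `^ (p - 1)) :
  forall u : nat -> R[i],
    finite_set [set n | u n != 0] -> u 0%N = 0 ->
    [/\ \sum_(1 <= n <oo) v n * cabs (u n - u n.-1) `^ p
        >= \sum_(1 <= n <oo) w n * cabs (u n) `^ p
           + \sum_(2 <= n <oo) v n * Rp p phi u n,
        (forall n : nat, (2 <= n)%N -> 0 < v n) ->
        (\sum_(2 <= n <oo) v n * Rp p phi u n = 0 <->
         exists c : R[i], forall n : nat, (1 <= n)%N ->
           u n = c * (phi n)%:C)
      & (forall n : nat, (1 <= n)%N ->
          v n * (phi n - phi n.-1) `^ (p - 1)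
            - v n.+1 * (phi n.+1 - phi n) `^ (p - 1)
          = w n * phi n `^ (p - 1)) ->
        \sum_(1 <= n <oo) v n * cabs (u n - u n.-1) `^ p
        = \sum_(1 <= n <oo) w n * cabs (u n) `^ p
          + \sum_(2 <= n <oo) v n * Rp p phi u n].
Proof.
move=> u /finite_support_bound[N0 uN0] u0.
have p0 : p != 0 by lra.
have [N N2 uN] : exists2 N, (2 <= N)%N & forall n, (N <= n)%N -> u n = 0.
  by exists N0.+2 => // n Nn; apply: uN0; lia.
have uN1 n : (N.+1 <= n)%N -> u n.-1 = 0 by case: n => // n; exact: uN.
have uN2 n : (N.+1 <= n)%N -> u n = 0 by move=> Nn; apply: uN; lia.
have RpN n : (N.+1 <= n)%N -> v n * Rp p phi u n = 0.
  move=> Nn; rewrite (_ : Rp _ _ _ _ = 0) ?mulr0//.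
  by rewrite /Rp uN1// uN2// !mul0r !mulr0 subrr !Cp0 mulr0 addr0.
have phip n : (2 <= n)%N -> 0 < phi n.-1 by move=> n2; apply: phi_gt0; lia.
have phile n : (2 <= n)%N -> phi n.-1 <= phi n.
  by case: n => // n n1; apply: phi_mono.
have -> : \sum_(1 <= n <oo) v n * cabs (u n - u n.-1) `^ p
    = \sum_(1 <= n < N.+1) v n * cabs (u n - u n.-1) `^ p.
  apply: lim_sum_eventually0 => // n Nn.
  by rewrite uN1// uN2// subr0 cabs0 powR0// mulr0.
have -> : \sum_(1 <= n <oo) w n * cabs (u n) `^ p
    = \sum_(1 <= n < N.+1) w n * cabs (u n) `^ p.
  by apply: lim_sum_eventually0 => // n Nn; rewrite uN2// cabs0 powR0// mulr0.
have -> : \sum_(2 <= n <oo) v n * Rp p phi u n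
    = \sum_(2 <= n < N.+1) v n * Rp p phi u n.
  by apply: lim_sum_eventually0 => //; lia.
pose D n := v n * (phi n - phi n.-1) `^ (p - 1).
pose g n := cabs (u n) `^ p / phi n `^ (p - 1).
(* phi 0 = 0 makes the denominator vanish, harmlessly: the numerator is 0. *)
have g0 : g 0%N = 0 by rewrite /g u0 cabs0 powR0// mul0r.
have gN : g N = 0 by rewrite /g uN// cabs0 powR0// mul0r.
have wE n : (1 <= n)%N -> w n * phi n `^ (p - 1) * g n = w n * cabs (u n) `^ p.
  move=> n1; rewrite /g -mulrA [X in _ * X]mulrC divfK//.
  by rewrite powR_eq0 gt_eqF ?phi_gt0.
have N1 : (1 < N.+1)%N by lia.
(* The term n = 1 has no remainder: u 0 = 0 and phi 0 = 0 make it D 1 * g 1. *)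
have energyE : \sum_(1 <= n < N.+1) v n * cabs (u n - u n.-1) `^ p
    = \sum_(1 <= n < N.+1) (D n - D n.+1) * g n
      + \sum_(2 <= n < N.+1) v n * Rp p phi u n.
  rewrite -(sum_by_parts _ g0 gN) ![\sum_(1 <= n < N.+1) _]big_ltn //.
  have -> : D 1%N * (g 1%N - g 1.-1) = v 1%N * cabs (u 1%N - u 1.-1) `^ p.
    rewrite /= g0 subr0 /D /g /= u0 phi0 !subr0 -mulrA; congr (_ * _).
    by rewrite mulrC divfK// powR_eq0 gt_eqF// phi_gt0.
  rewrite -addrA -big_split /=; congr (_ + _).
  apply: eq_big_nat => n /andP[n2 _].
  by rewrite (discrete_picone p_gt1 u (phip _ n2) (phile _ n2)) /D /g; ring.
rewrite energyE; split.
- rewrite lerD2r; apply: ler_sum_nat => n /andP[n1 _].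
  rewrite -wE// ler_wpM2r ?supersol//.
  by rewrite divr_ge0 ?powR_ge0.
- move=> v_gt0; split=> [/eqP|[c uc]].
    rewrite big_nat psumr_eq0 => [/allP RN|n /andP[n2 _]]; last first.
      by rewrite mulr_ge0 ?(ltW (v_gt0 _ n2))// Rp_ge0 ?phip ?phile.
    have Rn0 n : (2 <= n)%N -> Rp p phi u n = 0.
      move=> n2; apply/eqP; have : v n * Rp p phi u n == 0.
        have [nN|Nn] := ltnP n N.+1; last by rewrite RpN.
        by have := RN n; rewrite mem_index_iota n2 nN /= => /(_ isT).
      by rewrite mulf_eq0 gt_eqF ?v_gt0.
    exists (u 1%N / (phi 1%N)%:C) => n n1.
    have cphi0 m : (1 <= m)%N -> (phi m)%:C != 0.
      by move=> m1; rewrite fmorph_eq0 gt_eqF ?phi_gt0.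
    suff -> : u 1%N / (phi 1%N)%:C = u n / (phi n)%:C by rewrite divfK ?cphi0.
    elim: n n1 => // -[//|n] IH _; rewrite IH//.
    have := Rn0 n.+2 isT.
    by move=> /(Rp_eq0 p_gt1 u (phip n.+2 isT) (phile n.+2 isT)).
  rewrite big_nat big1// => n /andP[n2 _].
  rewrite (Rp_eq0 p_gt1 u (phip _ n2) (phile _ n2)).2 ?mulr0//.
  rewrite !uc ?mulfK ?fmorph_eq0 ?gt_eqF ?phip ?phi_gt0//; lia.
- move=> supersolE; congr (_ + _); apply: eq_big_nat => n /andP[n1 _].
  by rewrite -wE// -supersolE.
Qed.
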